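(* There is an absolute constant $K$ such that the following holds. Let $C \subseteq \{0,1\}^m$ be a code with $\mathrm{CL}(C) \ge 1$, let $w : [m] \to \mathbb{R}_{\ge 0}$ be weights, and let $\epsilon \in (0,1)$. Then there exists a $(1\pm\epsilon)$-sparsifier $\widetilde w$ of $C$ with respect to $w$ such that \[ |\operatorname{supp}(\widetilde w)| \le K\cdot \frac{\mathrm{CL}(C)\cdot \log^2(\mathrm{CL}(C)/\epsilon)\cdot \big(\log\log(\mathrm{CL}(C)/\epsilon)\big)^2}{\epsilon^2}. \]
   Context: A code is a subset $C \subseteq \{0,1\}^m$, where $[m]=\{1,\dots,m\}$ is the set of coordinates (equivalently, $C$ encodes a set system $\mathcal S \subseteq 2^{[m]}$ via indicator vectors). A chain of length $\ell$ in $C$ is a pair of injective maps $a:[\ell]\to[m]$ and $c:[\ell]\to C$ such that $c(i)_{a(i)} = 1$ for all $i\in[\ell]$, and $c(i)_{a(j)} = 0$ for all $1\le i<j\le \ell$. The chain length $\mathrm{CL}(C)$ is the maximum length of a chain in $C$ (it is $0$ if no chain of length $1$ exists). Given weights $w:[m]\to\mathbb{R}_{\ge 0}$ and $\epsilon>0$, a $(1\pm\epsilon)$-sparsifier of $C$ with respect to $w$ is a function $\widetilde w:[m]\to\mathbb{R}_{\ge0}$ such that for every $c\in C$, $(1-\epsilon)\sum_i w(i)c_i \le \sum_i \widetilde w(i) c_i \le (1+\epsilon)\sum_i w(i)c_i$. Here $\operatorname{supp}(\widetilde w)=\{i : \widetilde w(i)\neq 0\}$ (the set of retained coordinates). Logarithms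 are understood to be at least $1$, i.e. $\log x := \max\{\log_2 x, 1\}$. *)

(* Defs.v *)
From Stdlib Require Import Reals.
From mathcomp Require Import all_boot.
Set Implicit Arguments. Unset Strict Implicit. Unset Printing Implicit Defensive.

Definition word (m : nat) := {ffun 'I_m -> bool}.

Definition is_chain (m l : nat) (C : {set word m})
  (a : 'I_l -> 'I_m) (c : 'I_l -> word m) : bool :=
  [&& injectiveb a, injectiveb c,
      [forall i, c i \in C],
      [forall i, c i (a i)] &
      [forall i : 'I_l, forall j : 'I_l, (nat_of_ord i < nat_of_ord j)%N ==> ~~ c i (a j)]].

Definition has_chain (m l : nat) (C : {set word m}) : bool :=
  [exists a : {ffun 'I_l -> 'I_m}, exists c : {ffun 'I_l -> word m},
     is_chain C a c].

(* Chain length: maximum length of a chain (chains have length <= m since a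
   is injective); equals 0 if no chain of length 1 exists. *)
Definition CL (m : nat) (C : {set word m}) : nat :=
  \max_(l < m.+1 | @has_chain m l C) l.

Local Open Scope R_scope.

Definition wt (m : nat) (w : 'I_m -> R) (c : word m) : R :=
  \big[Rplus/0]_(i < m) (if c i then w i else 0).

Definition is_sparsifier (m : nat) (C : {set word m}) (w wt' : 'I_m -> R)
  (eps : R) : Prop :=
  (forall i, 0 <= wt' i) /\
  forall c, c \in C ->
    (1 - eps) * wt w c <= wt wt' c <= (1 + eps) * wt w c.

Definition supp (m : nat) (f : 'I_m -> R) : {set 'I_m} :=
  [set i | if Req_EM_T (f i) 0 then false else true].

Definition logc (x : R) : R := Rmax (ln x / ln 2) 1.

(* Main.v *)
(** Read a code as a family of sets.  A chain is a sequence of words none of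
    which is contained in the union of its predecessors, so chain length is
    superadditive along [U <= Y <= Z] when one deletes the coordinates in [U] and
    keeps only the words inside [Y]; this makes it a substitute for the rank of
    a linear code.

    Call [U] dense at scale [d] if, after deleting [U], every [Y] carries weight
    at least [d] times the chain length inside [Y].  Karger's contraction argument
    bounds the number of traces of weight at most [a * d] by a polynomial of
    degree [O(a)] in the number of coordinates, and superadditivity yields an
    increasing filtration [U_j], dense at scale [mu * 2^j], whose layers satisfy
    [sum_j w(U_(j+1) - U_j) / 2^(j+1) <= mu * CL].  Keep the few coordinates that
    are heavy for their layer, and double or drop each of the others according
    to a random sign.  A word only meets [O(log n)] relevant scales, so the
    relative error is [O(sqrt (CL / n) * log n)], while the support shrinks
    by a factor 5/8.  Iterating down to [CL * log^2 (CL / eps) / eps^2]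
    coordinates, the errors form an essentially geometric series. *)
Require Import Defs.
From Stdlib Require Import Reals.
From mathcomp Require Import all_boot.
From mathcomp Require Import all_order all_algebra.
From mathcomp Require Import boolp reals sequences exp Rstruct.
From mathcomp Require Import zify ring lra.
Set Implicit Arguments. Unset Strict Implicit. Unset Printing Implicit Defensive.
Import Order.TTheory GRing.Theory Num.Theory.

(** * Chain length of a family of sets *)

Section UnionChains.
Variables (T : finType) (F : {set {set T}}).
Implicit Types (U Y Z c : {set T}) (s : seq {set T}).

Fixpoint increasing_unions U s :=
  if s is c :: s' then ~~ (c \subset U) && increasing_unions (U :|: c) s' else true.

Definition union_chain U Y s :=
  all [pred c | (c \in F) && (c \subset Y)] s && increasing_unions U s.

(* The chain length of the code obtained from [F] by keeping the words inside [Y]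
   and deleting the coordinates in [U]. *)
Definition height U Y : nat :=
  \max_(l < #|T|.+1 | [exists s : l.-tuple {set T}, union_chain U Y s]) l.

Lemma increasing_unionsS U U' s :
  U \subset U' -> increasing_unions U' s -> increasing_unions U s.
Proof.
elim: s U U' => //= c s IHs U U' sUU' /andP[ncU' inc]; apply/andP; split.
  by apply: contra ncU' => /subset_trans; apply.
by apply: IHs inc; apply: setSU.
Qed.

Lemma increasing_unions_cat U s1 s2 :
  increasing_unions U (s1 ++ s2) =
  increasing_unions U s1 && increasing_unions (U :|: \bigcup_(c <- s1) c) s2.
Proof.
elim: s1 U => [|c s1 IHs] U /=; first by rewrite big_nil setU0.
by rewrite IHs big_cons setUA andbA.
Qed.

Lemma size_union_chain U Y s : union_chain U Y s -> size s <= #|Y :\: U|.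
Proof.
elim: s U => //= c s IHs U; rewrite /union_chain /= => /andP[/andP[/andP[Fc cY] allY]].
case/andP => ncU inc; apply: (@leq_ltn_trans #|Y :\: (U :|: c)|).
  by apply: IHs; rewrite /union_chain allY.
apply/proper_card/properP; split; first by apply: setDS; apply: subsetUl.
have [x xc xU] := subsetPn ncU; exists x; first by rewrite inE xU (subsetP cY).
by rewrite !inE xc orbT.
Qed.

Lemma size_le_height U Y s : union_chain U Y s -> size s <= height U Y.
Proof.
move=> chs; have lts : size s < #|T|.+1.
  by rewrite ltnS (leq_trans (size_union_chain chs)) ?max_card.
apply: (@leq_bigmax_cond _ _ (fun l : 'I__ => val l) (Ordinal lts)).
by apply/existsP; exists (in_tuple s).
Qed.

Lemma height_witness U Y : exists2 s, union_chain U Y s & size s = height U Y.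
Proof.
rewrite /height; have P0 : [exists s : (@ord0 #|T|).-tuple {set T}, union_chain U Y s].
  by apply/existsP; exists [tuple].
case: (@eq_bigmax_cond _ [pred l : 'I_#|T|.+1 |
  [exists s : l.-tuple {set T}, union_chain U Y s]] (fun l => val l)).
  by apply/card_gt0P; exists ord0.
by move=> l /existsP[s chs] ->; exists s; rewrite ?size_tuple.
Qed.

Lemma height_le_card U Y : height U Y <= #|Y :\: U|.
Proof. by have [s chs <-] := height_witness U Y; apply: size_union_chain. Qed.

Lemma heightS U U' Y Y' : U \subset U' -> Y' \subset Y -> height U' Y' <= height U Y.
Proof.
move=> sU sY; have [s /andP[allF inc] <-] := height_witness U' Y'.
apply: size_le_height; rewrite /union_chain (increasing_unionsS sU inc) andbT.
by apply: sub_all allF => c /= /andP[-> /subset_trans->].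
Qed.

Lemma bigcup_seq_sub Y s : all [pred c | (c \in F) && (c \subset Y)] s ->
  \bigcup_(c <- s) c \subset Y.
Proof.
elim: s => [|c s IHs] /=; first by rewrite big_nil sub0set.
by case/andP=> /andP[_ cY] /IHs sY; rewrite big_cons subUset cY.
Qed.

(** Concatenate two optimal chains: the words of the first lie in [Y], so a word that leaves [Y]
    also leaves their union with [U]. *)
Lemma height_cat U Y Z : U \subset Y -> Y \subset Z ->
  height U Y + height Y Z <= height U Z.
Proof.
move=> sUY sYZ; have [s1 /andP[all1 inc1] <-] := height_witness U Y.
have [s2 /andP[all2 inc2] <-] := height_witness Y Z.
rewrite -size_cat; apply: size_le_height; rewrite /union_chain all_cat all2 andbT.
apply/andP; split; first by apply: sub_all all1 => c /= /andP[-> /subset_trans->].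
rewrite increasing_unions_cat inc1; apply: increasing_unionsS inc2.
by rewrite subUset sUY bigcup_seq_sub.
Qed.

(** A chain inside [Y :\ j] can be extended by [c], which brings the new coordinate [j]. *)
Lemma height_remove U Y c j : c \in F -> c \subset Y -> j \in c -> j \notin U ->
  height U (Y :\ j) < height U Y.
Proof.
move=> Fc cY jc jU; have [s /andP[allF inc] <-] := height_witness U (Y :\ j).
rewrite -(size_rcons s c); apply: size_le_height.
rewrite /union_chain all_rcons -cats1 increasing_unions_cat inc /= Fc cY /= andbT.
apply/andP; split.
  by apply: sub_all allF => x /= /andP[-> /subset_trans->//]; rewrite subD1set.
apply/subsetPn; exists j; rewrite // inE negb_or jU.
by apply: contraTN jc => /(subsetP (bigcup_seq_sub allF)); rewrite !inE eqxx.
Qed.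

Lemma height_eq0_sub U Y c : height U Y = 0 -> c \in F -> c \subset Y -> c \subset U.
Proof.
move=> h0 Fc cY; apply: contraT => ncU.
have : size [:: c] <= height U Y by apply: size_le_height; rewrite /union_chain /= Fc cY ncU.
by rewrite h0.
Qed.

Lemma height_self U : height U U = 0.
Proof. by apply/eqP; rewrite -leqn0 (leq_trans (height_le_card _ _)) ?setDv ?cards0. Qed.

Definition traces U Y : {set {set T}} := [set c :\: U | c in F & c \subset Y].

Definition covered U Y : {set T} := cover (traces U Y).

Lemma coveredP U Y j : reflect
  (exists c, [/\ c \in F, c \subset Y, j \in c & j \notin U]) (j \in covered U Y).
Proof.
apply: (iffP bigcupP) => [[x /imsetP[c]]|[c [Fc cY jc jU]]].
  by rewrite !inE => /andP[Fc cY] ->; rewrite inE => /andP[jU jc]; exists c.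
by exists (c :\: U); rewrite ?inE ?jU //; apply/imsetP; exists c; rewrite ?inE ?Fc.
Qed.

Lemma height_covered U Y j : j \in covered U Y -> height U (Y :\ j) < height U Y.
Proof. by case/coveredP=> c [Fc cY jc jU]; exact: (height_remove Fc cY jc jU). Qed.

Lemma mem_traces_remove U Y x j : j \notin U -> x \in traces U Y -> j \notin x ->
  x \in traces U (Y :\ j).
Proof.
move=> jU /imsetP[c]; rewrite inE => /andP[Fc cY] -> jx; apply/imsetP; exists c => //.
by rewrite inE Fc subsetD1 cY; move: jx; rewrite inE jU.
Qed.

(** A count of Sauer type: every trace except possibly the full covered set misses a covered
    coordinate [j], hence is a trace inside [Y :\ j], where the height is smaller. There are at most
    [#|~: U|] choices of [j]. *)
Lemma card_traces U Y : #|traces U Y| <= #|~: U|.+1 ^ height U Y.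
Proof.
move: {2}(height U Y) (leqnn (height U Y)) => h; elim: h Y => [|h IHh] Y.
  rewrite leqn0 => /eqP h0; rewrite h0 expn0.
  apply: (@leq_trans #|[set (set0 : {set T})]|); last by rewrite cards1.
  apply/subset_leq_card/subsetP => x /imsetP[c]; rewrite !inE => /andP[Fc cY] ->.
  by rewrite setD_eq0; apply: height_eq0_sub cY.
rewrite leq_eqVlt ltnS => /orP[/eqP hY|]; last exact: IHh.
have sub : traces U Y \subset
    covered U Y |: \bigcup_(j in covered U Y) traces U (Y :\ j).
  apply/subsetP => x xin; rewrite !inE; case: eqVneq => //= neq.
  have : ~~ (covered U Y \subset x).
    apply: contraNN neq => sub; rewrite eqEsubset sub andbT.
    exact: (bigcup_sup x xin).
  case/subsetPn => j jin jx; apply/bigcupP; exists j => //.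
  by apply: mem_traces_remove => //; case/coveredP: jin => c [].
apply: (leq_trans (subset_leq_card sub)); apply: (leq_trans (leq_card_setU _ _)).
have sumle : \sum_(j in covered U Y) #|traces U (Y :\ j)| <= #|~: U| * #|~: U|.+1 ^ h.
  apply: (@leq_trans (\sum_(j in covered U Y) #|~: U|.+1 ^ h)).
    apply: leq_sum => j jin; have hlt := height_covered jin.
    rewrite hY ltnS in hlt; apply: leq_trans (IHh _ hlt) _.
    by rewrite leq_pexp2l.
  rewrite sum_nat_const leq_mul2r; apply/orP; right.
  by apply/subset_leq_card/subsetP => j /coveredP[c [_ _ _ jU]]; rewrite inE.
rewrite cards1 hY expnS mulSn leq_add ?expn_gt0 //.
apply: leq_trans sumle; elim/big_rec2: _ => [|j n A _ le]; first by rewrite cards0.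
by apply: (leq_trans (leq_card_setU _ _)); rewrite leq_add2l.
Qed.

End UnionChains.

(** * Dense sets of coordinates *)

Local Open Scope ring_scope.

(** Closing computation of [card_light_traces]: [W / (W - t * d)] is at most [r / (r - t)], hence at
    most [(r + 2 * t) / r] because [2 * t < r]; the Bernoulli hypothesis absorbs this factor into
    the passage from [p] to [q]. *)
Lemma contraction_arith (R : realFieldType) (x W b p q r t d : R) :
  0 < d -> 0 <= b -> 0 < t -> 0 <= p -> 0 < r -> t * 2 < r ->
  p * (r + t * 2) <= r * q -> x * (W - t * d) <= W * (b * p) -> d * r <= W -> x <= b * q.
Proof.
move=> d0 b0 t0 p0 r0 ha bern key wS.
have td : 0 < t * d by rewrite mulr_gt0.
have h1 : d * (t * 2) <= d * r by rewrite ler_pM2l // ltW.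
have pos : 0 < W - t * d by lra.
have poly : W * r <= (W - t * d) * (r + t * 2).
  have h2 : 0 <= t * (2 * W - d * r - d * (t * 2)) by apply: mulr_ge0; [exact: ltW|lra].
  by nra.
rewrite -(ler_pM2r (mulr_gt0 pos r0)).
apply: (@le_trans _ _ (W * (b * p) * r)); first by rewrite mulrA ler_pM2r.
apply: (@le_trans _ _ ((b * p) * ((W - t * d) * (r + t * 2)))).
  by rewrite (_ : W * _ * r = b * p * (W * r)); [rewrite ler_wpM2l ?mulr_ge0|ring].
rewrite (_ : b * p * _ = (b * (W - t * d)) * (p * (r + t * 2))); last by ring.
rewrite (_ : b * q * _ = (b * (W - t * d)) * (r * q)); last by ring.
by rewrite ler_wpM2l // mulr_ge0 // ltW.
Qed.

Section Density.
Variables (R : realType) (T : finType) (F : {set {set T}}) (w : T -> R).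
Hypothesis w_ge0 : forall i, 0 <= w i.
Implicit Types (A B U Y Z c : {set T}) (d : R).

Definition weight (A : {set T}) : R := \sum_(i in A) w i.

Lemma weight_ge0 A : 0 <= weight A.
Proof. exact: sumr_ge0. Qed.

Lemma weightD A B : A \subset B -> weight B = weight A + weight (B :\: A).
Proof. by move=> sAB; rewrite /weight (big_setID A) /= (setIidPr sAB). Qed.

Lemma weightS A B : A \subset B -> weight A <= weight B.
Proof. by move=> /weightD->; rewrite lerDl weight_ge0. Qed.

Definition dense d U := forall Y, U \subset Y -> d * (height F U Y)%:R <= weight (Y :\: U).

(* If density failed at the largest [V] satisfying the weight bound, then by
   [height_cat] the violating set would satisfy the bound as well. *)
Lemma exists_dense d U : 0 <= d -> exists V : {set T}, [/\ U \subset V, dense d V &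
  weight (V :\: U) <= d * ((height F U setT)%:R - (height F V setT)%:R)].
Proof.
move=> d0; pose P (V : {set T}) := (U \subset V) &&
  (weight (V :\: U) <= d * ((height F U setT)%:R - (height F V setT)%:R)).
have PU : P U by rewrite /P subxx setDv /weight big_set0 subrr mulr0 lexx.
case: (@arg_maxnP _ U P (fun V : {set T} => #|V|) PU) => V /andP[sUV wV] maxV.
exists V; split => // Y sVY; rewrite leNgt; apply/negP => wlt.
have sUY := subset_trans sUV sVY.
have hcat := height_cat F sVY (subsetT Y).
have PY : P Y.
  rewrite /P sUY; have -> : weight (Y :\: U) = weight (V :\: U) + weight (Y :\: V).
    rewrite (@weightD (V :\: U)) ?setSD //; congr (_ + weight _).
    by apply/setP => x; rewrite !inE; case: (x \in U) (subsetP sUV x) => [->|_] //=; rewrite ?andbT.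
  have : d * ((height F V Y)%:R + (height F Y setT)%:R) <= d * (height F V setT)%:R.
    by rewrite ler_wpM2l // -natrD ler_nat.
  move: wV wlt; rewrite !mulrBr mulrDr; lra.
have eqYV : V = Y by apply/eqP; rewrite eqEcard sVY; apply: maxV.
by move: wlt; rewrite eqYV height_self mulr0 ltNge weight_ge0.
Qed.

Definition light_traces U Y (t : R) := [set x in traces F U Y | weight x <= t].

(* Karger's contraction argument: a trace of weight at most [a * d] misses a
   coordinate drawn with probability proportional to [w] with probability at
   least [1 - a / height], and forcing that coordinate to 0 lowers the height. *)
Lemma card_light_traces d U (a : nat) Y : 0 < d -> dense d U -> U \subset Y -> (0 < a)%N ->
  (#|light_traces U Y (a%:R * d)| <=
     #|~: U|.+1 ^ (a.*2) * (height F U Y).+1 ^ (a.*2))%N.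
Proof.
move=> d0 dU sUY a0.
(* Up to height [2 * a], the bound on all traces is already good enough. *)
have base Z : (height F U Z <= a.*2)%N ->
    (#|light_traces U Z (a%:R * d)| <=
       #|~: U|.+1 ^ a.*2 * (height F U Z).+1 ^ a.*2)%N.
  move=> ha; apply: leq_trans (leq_pmulr _ _); last by rewrite expn_gt0.
  apply: (@leq_trans #|traces F U Z|).
    by apply/subset_leq_card/subsetP => x; rewrite inE => /andP[].
  by apply: leq_trans (card_traces _ _ _) _; rewrite leq_pexp2l.
move: {2}(height F U Y) (leqnn (height F U Y)) => h.
elim: h Y sUY => [|h IHh] Y sUY.
  by rewrite leqn0 => /eqP h0; apply: base; rewrite h0.
case: (leqP (height F U Y) a.*2) => [/base//|ha].
rewrite leq_eqVlt ltnS => /orP[/eqP hY|]; last exact: IHh.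
set X := light_traces U Y _; set S := covered F U Y; set B := (_.+1 ^ _)%N.
(* An optimal chain inside [Y] also lies inside [U :|: S], so density is applied to that set, whose
   part outside [U] is [S]. *)
have wS : d * h.+1%:R <= weight S.
  have -> : S = (U :|: S) :\: U.
    apply/setP => j; rewrite !inE; case: (boolP (j \in S)) => [/coveredP[c [_ _ _ ->]]|_].
      by rewrite orbT.
    by rewrite orbF andNb.
  apply: le_trans (dU _ (subsetUl _ _)); rewrite ler_pM2l // ler_nat -hY.
  have [s /andP[allF inc] <-] := height_witness F U Y.
  apply: size_le_height; rewrite /union_chain inc andbT.
  apply: sub_all allF => c /= /andP[Fc cY]; rewrite Fc /=.
  apply/subsetP => j jc; rewrite inE; case: (boolP (j \in U)) => //= jU.
  by apply/coveredP; exists c.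
have cardX j : j \in S -> (#|[set x in X | j \notin x]| <= B * h.+1 ^ a.*2)%N.
  move=> jS; have [c [Fc cY jc jU]] := coveredP _ _ _ _ jS.
  have hlt := height_covered jS; rewrite hY ltnS in hlt.
  have sUYj : U \subset Y :\ j by rewrite subsetD1 sUY.
  apply: (@leq_trans #|light_traces U (Y :\ j) (a%:R * d)|).
    apply/subset_leq_card/subsetP => x; rewrite !inE => /andP[/andP[xin ->] jx].
    by rewrite andbT; apply: mem_traces_remove.
  by apply: leq_trans (IHh _ sUYj hlt) _; rewrite leq_mul2l leq_exp2r ?ltnS ?hlt ?orbT ?double_gt0.
(* Double counting of pairs of a light trace [x] and a coordinate [j] of [S] outside [x], weighted
   by [w j]. Each [x] contributes at least [weight S - a * d], and each [j] occurs with at most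
   [B * h.+1 ^ a.*2] traces. *)
have key : #|X|%:R * (weight S - a%:R * d) <= weight S * (B * h.+1 ^ a.*2)%:R.
  have -> : #|X|%:R * (weight S - a%:R * d) = \sum_(x in X) (weight S - a%:R * d).
    by rewrite sumr_const -[RHS]mulr_natl.
  apply: (@le_trans _ _ (\sum_(x in X) \sum_(j in S | j \notin x) w j)).
    apply: ler_sum => x; rewrite inE => /andP[xin wx].
    have sx : x \subset S by apply: (bigcup_sup x xin).
    rewrite (weightD sx) (_ : \sum_(_ in _ | _) _ = weight (S :\: x)); first lra.
    by apply: eq_bigl => j; rewrite inE andbC.
  rewrite (exchange_big_dep (mem S)) /=; last by move=> x j _ /andP[].
  rewrite /weight mulr_suml; apply: ler_sum => j jS.
  rewrite (eq_bigl (fun x => x \in [set x in X | j \notin x])); last first.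
    by move=> x /=; rewrite jS [RHS]in_set.
  by rewrite sumr_const -[leLHS]mulr_natr ler_wpM2l // ler_nat cardX.
(* Bernoulli's inequality for [(1 + 1 / h.+1) ^ a.*2], with denominators cleared. *)
have bern : (h.+1 ^ a.*2 * (h.+1 + a.*2) <= h.+1 * h.+2 ^ a.*2)%N.
  elim: (a.*2) => [|k IHk]; first by rewrite !expn0 addn0 muln1 mul1n.
  have := IHk; rewrite !expnS; set p := (h.+1 ^ k)%N; set q := (h.+2 ^ k)%N => le.
  have : (h.+2 * (p * (h.+1 + k)) <= h.+2 * (h.+1 * q))%N by rewrite leq_mul2l le orbT.
  nia.
rewrite hY -(ler_nat R) natrM.
apply: (@contraction_arith _ _ (weight S) _ (h.+1 ^ a.*2)%:R _ h.+1%:R a%:R d) => //.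
- by rewrite ltr0n.
- by rewrite -natrM ltr_nat muln2 -hY.
- by move: bern; rewrite -(ler_nat R) !natrM natrD -(muln2 a) natrM.
by rewrite -natrM.
Qed.

End Density.

(** * Random signs *)

Section Signs.
Variable R : realType.
Implicit Types x y b : R.

(** For [x] in [0, 1/2], [expR (- y) <= 1 / (1 + y)] bounds the left side by [2 / (1 - x ^ 2)];
    beyond 1/2, [x <= 2 * x ^ 2] is enough. The non-optimal constant only affects the final absolute
    constant. *)
Lemma cosh_le x : expR x + expR (- x) <= 2 * expR (2 * x ^+ 2).
Proof.
wlog x0 : x / 0 <= x => [wl|].
  case: (lerP 0 x) => [/wl//|xlt0].
  by rewrite addrC -[X in X + _]/(expR (- x)) -{2}[x]opprK -[x ^+ 2]sqrrN; apply: wl; lra.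
case: (lerP x (1/2)) => [xle|xgt].
  have inv y : 0 < 1 + y -> expR (- y) <= (1 + y)^-1.
    by move=> y1; rewrite expRN lef_pV2 ?posrE ?expR_gt0 ?expR_ge1Dx.
  have e1 : expR x <= (1 - x)^-1 by have := inv (- x); rewrite opprK; apply; lra.
  have e2 : expR (- x) <= (1 + x)^-1 by apply: inv; lra.
  have e3 := expR_ge1Dx (2 * x ^+ 2).
  apply: (le_trans (lerD e1 e2)).
  apply: (@le_trans _ _ (2 * (1 + 2 * x ^+ 2))); last by lra.
  rewrite -(ler_pM2r (_ : 0 < (1 - x) * (1 + x))); last by nra.
  rewrite (_ : _ * _ = 2); last by field; rewrite lt0r_neq0 /=; lra.
  have : 0 <= x ^+ 2 * (1 - 2 * x ^+ 2) by rewrite mulr_ge0 ?sqr_ge0 //; nra.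
  nra.
have h1 : expR x <= expR (2 * x ^+ 2) by rewrite ler_expR; nra.
have h2 : expR (- x) <= expR x by rewrite ler_expR; lra.
lra.
Qed.

Definition sgn_sum (T : finType) (s : {ffun T -> bool}) (x : T -> R) : R :=
  \sum_e (if s e then x e else - x e).

Lemma mgf_le (T : finType) (x : T -> R) :
  \sum_(s : {ffun T -> bool}) expR (sgn_sum s x) <=
  2 ^+ #|T| * expR (2 * \sum_e x e ^+ 2).
Proof.
have -> : \sum_(s : {ffun T -> bool}) expR (sgn_sum s x) =
          \prod_e (expR (x e) + expR (- x e)).
  transitivity (\prod_e \sum_(b : bool) expR (if b then x e else - x e)).
    by rewrite bigA_distr_bigA /=; apply: eq_bigr => s _; rewrite expR_sum.
  by apply: eq_bigr => e _; rewrite big_bool.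
rewrite mulr_sumr expR_sum -prodr_const -big_split /=.
by apply: ler_prod => e _; rewrite addr_ge0 ?expR_ge0 // cosh_le.
Qed.

Lemma sgn_sum_scale (T : finType) s (x : T -> R) a :
  sgn_sum s (fun e => a * x e) = a * sgn_sum s x.
Proof. by rewrite /sgn_sum mulr_sumr; apply: eq_bigr => e _; case: ifP; rewrite ?mulrN. Qed.

(** Hoeffding's inequality and a union bound, with a separate confidence [b k] for each index. If
    every sign vector failed somewhere, the sum over all vectors of the exponential moments
    [expR (- (2 * b k)) * G k s] would be at least [2 ^ #|T|], against the smallness hypothesis. *)
Lemma signs_exist (T I : finType) (P : pred I) (x : I -> T -> R) (b : I -> R) :
  (forall k, P k -> 0 <= b k) ->
  \sum_(k | P k) 2 * expR (- b k) < 1 ->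
  exists s : {ffun T -> bool}, forall k, P k ->
    sgn_sum s (x k) ^+ 2 <= 8 * b k * \sum_e x k e ^+ 2.
Proof.
move=> b0 small; pose V k := \sum_e x k e ^+ 2.
have V0 k : 0 <= V k by apply: sumr_ge0 => e _; apply: sqr_ge0.
pose good s := [forall k, P k ==> (sgn_sum s (x k) ^+ 2 <= 8 * b k * V k)].
case: (pickP good) => [s /forallP gs|bad].
  by exists s => k Pk; apply: (implyP (gs k)).
(* The Chernoff-optimal parameter; the junk value [lam k = 0] when [V k = 0] is harmless. *)
pose lam k := Num.sqrt (b k / (2 * V k)).
pose G k s := expR (lam k * sgn_sum s (x k)) + expR (- (lam k * sgn_sum s (x k))).
have key k s : P k -> ~~ (sgn_sum s (x k) ^+ 2 <= 8 * b k * V k) ->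
    1 <= expR (- (2 * b k)) * G k s.
  move=> Pk; rewrite -ltNge => lt; have bk := b0 k Pk.
  have Vgt0 : 0 < V k.
    rewrite lt_def V0 andbT; apply/eqP => Vz.
    have xz e : x k e = 0.
      have /psumr_eq0P := Vz; move=> /(_ (fun e _ => sqr_ge0 _)) /(_ e isT) /eqP.
      by rewrite sqrf_eq0 => /eqP.
    move: lt; rewrite Vz mulr0 /sgn_sum big1 ?expr0n ?ltxx // => e _.
    by rewrite xz oppr0 if_same.
  set y := lam k * sgn_sum s (x k).
  have y2 : (2 * b k) ^+ 2 <= y ^+ 2.
    rewrite /y /lam [leRHS]exprMn sqr_sqrtr ?divr_ge0 ?mulr_ge0 //.
    have -> : (2 * b k) ^+ 2 = b k / (2 * V k) * (8 * b k * V k).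
      by field; rewrite lt0r_neq0.
    by rewrite ler_wpM2l ?divr_ge0 ?mulr_ge0 // ltW.
  have absy : 2 * b k <= `|y|.
    by rewrite -(ler_pXn2r (_ : 0 < 2)%N) ?nnegrE ?mulr_ge0 // real_normK ?num_real.
  rewrite expRN mulrC ler_pdivlMr ?expR_gt0 // mul1r /G -/y.
  apply: (@le_trans _ _ (expR `|y|)); first by rewrite ler_expR.
  have e1 := expR_ge0 y; have e2 := expR_ge0 (- y).
  by case/orP: (le_total 0 y) => hy; [rewrite ger0_norm|rewrite ler0_norm] => //; lra.
have mgf k : P k -> expR (- (2 * b k)) * (\sum_s G k s) <= 2 ^+ #|T| * (2 * expR (- b k)).
  move=> Pk; have bk := b0 k Pk.
  have one (a : R) : a ^+ 2 = lam k ^+ 2 ->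
      \sum_(s : {ffun T -> bool}) expR (a * sgn_sum s (x k)) <= 2 ^+ #|T| * expR (b k).
    move=> a2; under eq_bigr do rewrite -sgn_sum_scale.
    apply: (le_trans (mgf_le _)); rewrite ler_pM2l ?exprn_gt0 // ler_expR.
    under eq_bigr do rewrite exprMn.
    rewrite -mulr_sumr -/(V k) a2 /lam sqr_sqrtr ?divr_ge0 ?mulr_ge0 //.
    have [Vz|Vnz] := eqVneq (V k) 0; first by rewrite Vz !mulr0.
    by rewrite le_eqVlt; apply/orP; left; apply/eqP; field.
  rewrite /G big_split /=; have h1 := one _ (erefl _).
  have h2 := one (- lam k) (sqrrN _).
  under [X in _ * (_ + X)]eq_bigr do rewrite -mulNr.
  have := lerD h1 h2; set A := _ + _; move=> hA.
  apply: (@le_trans _ _ (expR (- (2 * b k)) * (2 ^+ #|T| * expR (b k) + 2 ^+ #|T| * expR (b k)))).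
    by rewrite ler_wpM2l ?expR_ge0.
  have -> : - b k = - (2 * b k) + b k by ring.
  rewrite exp.expRD; set u := expR _; set v := expR _; set z := 2 ^+ _.
  by rewrite le_eqVlt; apply/orP; left; apply/eqP; ring.
have : (2 ^+ #|T| : R) <= 2 ^+ #|T| * \sum_(k | P k) 2 * expR (- b k).
  rewrite mulr_sumr; apply: le_trans (ler_sum _ mgf).
  under [leRHS]eq_bigr do rewrite mulr_sumr.
  rewrite exchange_big /=.
  have -> : (2 ^+ #|T| : R) = \sum_(s : {ffun T -> bool}) 1.
    by rewrite sumr_const card_ffun card_bool -natrX.
  apply: ler_sum => s _; have := bad s; rewrite /good => /negbT.
  rewrite negb_forall => /existsP[k]; rewrite negb_imply => /andP[Pk nk].
  rewrite (bigD1 k) //=; apply: (le_trans (key _ _ Pk nk)); rewrite lerDl.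
  by apply: sumr_ge0 => j _; rewrite mulr_ge0 ?addr_ge0 ?expR_ge0.
by rewrite -subr_ge0 -{2}[2 ^+ _]mulr1 -mulrBr pmulr_rge0 ?exprn_gt0 // subr_ge0 leNgt small.
Qed.

End Signs.

(** * Deviations at all scales *)

Lemma sum_geometric_le (R : realFieldType) (y : R) N : 0 <= y -> y <= 1/2 ->
  \sum_(k < N) y ^+ k.+1 <= 2 * y.
Proof.
move=> y0 y2; elim: N => [|N IHN]; first by rewrite big_ord0 mulr_ge0.
rewrite big_ord_recl /= expr1 (eq_bigr (fun k : 'I_N => y * y ^+ k.+1)); last first.
  by move=> k _; rewrite /bump /= add1n -exprS.
rewrite -mulr_sumr; have := ler_wpM2l y0 IHN; nra.
Qed.

(** Group the elements by the value of [a]: the group of value [k] contributes at most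
    [(Q * q) ^ k], and these terms decay geometrically. *)
Lemma sum_exp_count_le (R : realFieldType) (X : finType) (S : {set X}) (a : X -> nat) (Q q : R) :
  (forall x, x \in S -> (0 < a x)%N) ->
  (forall k, (0 < k)%N -> #|[set x in S | (a x <= k)%N]|%:R <= Q ^+ k) ->
  0 <= q -> 0 <= Q -> Q * q <= 1/2 ->
  \sum_(x in S) q ^+ a x <= 2 * (Q * q).
Proof.
move=> a0 cnt q0 Q0 Qq; pose N := \max_x a x.
apply: le_trans (sum_geometric_le N (mulr_ge0 Q0 q0) Qq).
have split x : x \in S -> q ^+ a x = \sum_(k < N | a x == k.+1) q ^+ k.+1.
  move=> xS; have lt : ((a x).-1 < N)%N by rewrite prednK ?a0 // (leq_bigmax x).
  rewrite (big_pred1 (Ordinal lt)) /= ?prednK ?a0 // => k.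
  by apply/eqP/eqP => [h|->]; [apply/val_inj; rewrite /= h|rewrite /= prednK ?a0].
rewrite (eq_bigr _ split) (exchange_big_dep predT) //=; apply: ler_sum => k _.
rewrite sumr_const -mulr_natl exprMn ler_wpM2r ?exprn_ge0 //.
apply: le_trans (cnt k.+1 isT); rewrite ler_nat; apply/subset_leq_card/subsetP => x.
by rewrite !inE => /andP[-> /eqP->] /=.
Qed.

Lemma sqr_sum_le (R : realFieldType) (I : finType) (P : pred I) (x : I -> R) :
  (\sum_(i | P i) x i) ^+ 2 <= #|P|%:R * \sum_(i | P i) x i ^+ 2.
Proof.
case: (posnP #|P|) => [P0|Pgt0].
  by rewrite big_pred0 ?P0 ?mul0r ?expr0n //; apply/card0_eq.
set S := \sum_(i | P i) x i; set Q := \sum_(i | P i) _; set k : R := #|P|%:R.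
have k0 : 0 < k by rewrite ltr0n.
(* Cauchy-Schwarz as nonnegativity of a variance, scaled by [k] to avoid division. *)
have : 0 <= \sum_(i | P i) (k * x i - S) ^+ 2 by apply: sumr_ge0 => i _; apply: sqr_ge0.
have -> : \sum_(i | P i) (k * x i - S) ^+ 2 = k * (k * Q - S ^+ 2).
  transitivity (\sum_(i | P i) (k ^+ 2 * x i ^+ 2 + (- 2 * k * S) * x i + S ^+ 2)).
    by apply: eq_bigr => i _; ring.
  by rewrite !big_split /= -!mulr_sumr sumr_const -mulr_natl -/k -/S -/Q; ring.
by rewrite pmulr_rge0 // subr_ge0.
Qed.

Lemma sum_scales_le (R : realFieldType) (mu B : R) J : 0 < mu -> 0 <= B ->
  \sum_(j < J | mu * 2 ^+ j <= B) mu * 2 ^+ j <= 2 * B.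
Proof.
move=> mu0 B0; elim: J => [|J IHJ]; first by rewrite big_ord0 mulr_ge0.
rewrite big_mkcond big_ord_recr /= -big_mkcond /=; case: ifP => [le|_]; last by rewrite addr0.
have : \sum_(j < J | mu * 2 ^+ j <= B) mu * 2 ^+ j <= mu * 2 ^+ J; last by lra.
apply: (@le_trans _ _ (\sum_(j < J) mu * 2 ^+ j)).
  rewrite big_mkcond /=; apply: ler_sum => j _; case: ifP => // _.
  by rewrite mulr_ge0 ?exprn_ge0 // ltW.
elim: (J) => [|k IHk]; first by rewrite big_ord0 mulr_ge0 ?exprn_ge0 // ltW.
by rewrite big_ord_recr /= exprS; lra.
Qed.

(** All the scales counted lie within a factor [n <= 2 ^ K] of the smallest one, so their indices
    fill at most [K] consecutive places. *)
Lemma card_scales_le (R : realFieldType) (mu W : R) (n K J : nat) : 0 < mu ->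
  (n <= 2 ^ K)%N ->
  (#|[pred j : 'I_J | (W < n%:R * (mu * 2 ^+ j))%R && (mu * 2 ^+ j <= W)%R]| <= K)%N.
Proof.
move=> mu0 nK; set P := [pred j : 'I_J | _].
case: (pickP P) => [j1 Pj1|P0]; last by rewrite eq_card0.
case: (@arg_minnP _ j1 P (fun j => val j) Pj1) => j0 /andP[Wj0 _] minj0.
rewrite cardE -(size_map val) -[leqRHS](size_iota (val j0)).
apply: uniq_leq_size; first by rewrite (map_inj_uniq val_inj) enum_uniq.
move=> _ /mapP[j jP ->]; rewrite mem_enum in jP; rewrite mem_iota minj0 //=.
case/andP: jP => _ jW; have := le_lt_trans jW Wj0.
rewrite mulrCA ltr_pM2l // -!natrX -natrM ltr_nat => lt.
have : (2 ^ j < 2 ^ (j0 + K))%N.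
  by apply: (leq_trans lt); rewrite expnD mulnC leq_mul2l nK orbT.
by rewrite ltn_exp2l.
Qed.

Section Levels.
Variables (R : realType) (T : finType) (F : {set {set T}}) (w : T -> R).
Hypothesis w_ge0 : forall i, 0 <= w i.
Implicit Types (U A c x : {set T}).

(** For [d > 0], the least [a] with [weight w x < a * d]. It is always positive, as
    [card_light_traces] requires. *)
Definition multiplicity (d : R) x : nat := (Num.truncn (weight w x / d)).+1.

Lemma multiplicity_le (d : R) x : 0 < d -> d <= weight w x ->
  (multiplicity d x)%:R <= 2 * weight w x / d.
Proof.
move=> d0 dW; have W0 := weight_ge0 w_ge0 x.
have := Num.Theory.truncn_le (weight w x / d); rewrite divr_ge0 ?(ltW d0) // => le1.
have le2 : 1 <= weight w x / d by rewrite ler_pdivlMr // mul1r.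
by rewrite /multiplicity -natr1 -mulrA; lra.
Qed.

Lemma expR_ge_expn2 K : 2 ^+ K <= expR (K%:R : R).
Proof.
rewrite -[K%:R]mulr1 expRM_natl; apply: lerXn2r; rewrite ?nnegrE ?expR_ge0 //.
by have := expR_ge1Dx (1 : R); lra.
Qed.

(** With [N = n + 1], at most [N ^ (4 * k)] traces have multiplicity at most [k], while a trace of
    multiplicity [k] contributes at most [N ^ (- 8 * k)]. The resulting series has ratio at most
    [N ^ (- 4)]. *)
Lemma sum_expR_multiplicity (d : R) U (n K : nat) : 0 < d -> dense F w d U ->
  (#|~: U| <= n)%N -> (0 < n)%N -> (n.+1 <= 2 ^ K)%N ->
  \sum_(x in traces F U setT) expR (- (8 * K%:R * (multiplicity d x)%:R) : R) <=
  2 / n.+1%:R ^+ 4.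
Proof.
move=> d0 dU Un n0 nK; set N : R := n.+1%:R.
have N2 : 2 <= N by rewrite ler_nat.
have N0 : 0 < N by lra.
under eq_bigr do rewrite mulrC -mulrN expRM_natl.
set q := expR _.
have qN : q <= N ^- 8.
  rewrite /q expRN lef_pV2 ?posrE ?exprn_gt0 ?expR_gt0 // expRM_natl.
  apply: lerXn2r; rewrite ?nnegrE ?expR_ge0 ?(ltW N0) //.
  by apply: le_trans (expR_ge_expn2 K); rewrite -natrX ler_nat.
have Qq : N ^+ 4 * q <= N ^- 4.
  apply: (@le_trans _ _ (N ^+ 4 * N ^- 8)); first by rewrite ler_pM2l ?exprn_gt0.
  by rewrite (exprD N 4 4) invfM mulrA divff ?mul1r // expf_neq0 // lt0r_neq0.
have N4 : N ^- 4 <= 1/2.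
  rewrite div1r lef_pV2 ?posrE ?exprn_gt0 //.
  apply: (le_trans N2); rewrite -{1}[N]expr1; apply: ler_weXn2l => //; lra.
apply: (@le_trans _ _ (2 * (N ^+ 4 * q))); last by rewrite ler_pM2l.
apply: sum_exp_count_le => [x _||||]; rewrite ?expR_ge0 ?exprn_ge0 ?(ltW N0) //.
- move=> k k0; rewrite -exprM -natrX ler_nat.
  apply: (@leq_trans (n.+1 ^ k.*2 * n.+1 ^ k.*2)); last first.
    by rewrite -expnD leq_pexp2l // -addnn; lia.
  apply: (@leq_trans (#|~: U|.+1 ^ k.*2 * (height F U setT).+1 ^ k.*2)); last first.
    apply: leq_mul.
      by rewrite leq_exp2r ?double_gt0 // ltnS; exact: Un.
    rewrite leq_exp2r ?double_gt0 // ltnS; apply: leq_trans (height_le_card F U setT) _.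
    by rewrite setTD; exact: Un.
  apply: leq_trans (card_light_traces w_ge0 d0 dU (subsetT _) k0).
  apply/subset_leq_card/subsetP => x; rewrite !inE => /andP[-> xk] /=.
  rewrite -ler_pdivrMr // ltW //; apply: lt_le_trans (truncnS_gt _) _.
  by rewrite ler_nat.
- exact: le_trans Qq N4.
Qed.

(** The change in the weight of [A] when the coordinates with sign [true] are doubled and the others
    dropped. *)
Definition dev (s : {ffun T -> bool}) A : R := \sum_(e in A) (if s e then w e else - w e).

(** Union bound over pairs of a level and a trace. Only levels with [N j] nonempty count, so there
    are at most [n] of them however large [J] is, and each fails with probability at most
    [4 / (n + 1) ^ 4]. Since [N j] avoids [U j], the set [c :&: N j] depends only on the trace of
    [c]. *)
Lemma level_signs (J n K : nat) (U N : nat -> {set T}) (d : nat -> R) :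
  (forall j, 0 < d j) -> (forall j, dense F w (d j) (U j)) ->
  (forall j, (#|~: U j| <= n)%N) -> (forall j, N j \subset ~: U j) ->
  (\sum_(j < J) #|N j| <= n)%N -> (0 < n)%N -> (n.+1 <= 2 ^ K)%N ->
  exists s, forall (j : 'I_J) c, c \in F ->
    dev s (c :&: N j) ^+ 2 <=
    64 * K%:R * (multiplicity (d j) (c :\: U j))%:R * \sum_(e in c :&: N j) w e ^+ 2.
Proof.
move=> d0 dU Un NU sumN n0 nK.
pose P (k : 'I_J * {set T}) := (N k.1 != set0) && (k.2 \in traces F (U k.1) setT).
pose b (k : 'I_J * {set T}) : R := 8 * K%:R * (multiplicity (d k.1) k.2)%:R.
pose v (k : 'I_J * {set T}) e := if e \in k.2 :&: N k.1 then w e else 0.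
have [k _||s Hs] := @signs_exist R T _ P v b; first by rewrite !mulr_ge0.
  rewrite -(pair_big_dep (fun j : 'I_J => N j != set0)
    (fun j x => x \in traces F (U j) setT) (fun j x => 2 * expR (- b (j, x)))) /=.
  set y : R := 2 / n.+1%:R ^+ 4.
  apply: (@le_lt_trans _ _ (\sum_(j < J) (#|N j|%:R * (2 * y)))).
    rewrite big_mkcond /=; apply: ler_sum => j _; have [->|Nj] := eqVneq (N j) set0.
      by rewrite cards0 mul0r.
    rewrite -mulr_sumr; apply: (@le_trans _ _ (2 * y)).
      apply: ler_wpM2l; first by [].
      exact: (sum_expR_multiplicity (d0 j) (dU j) (Un j) n0 nK).
    rewrite ler_peMl ?mulr_ge0 ?invr_ge0 ?exprn_ge0 //.
    by rewrite (ler_nat _ 1) card_gt0.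
  rewrite -mulr_suml -natr_sum.
  apply: (@le_lt_trans _ _ (n%:R * (2 * y))).
    by rewrite ler_wpM2r ?mulr_ge0 ?invr_ge0 ?exprn_ge0 // ler_nat.
  rewrite /y !mulrA ltr_pdivrMr ?exprn_gt0 // mul1r -natrX -!natrM ltr_nat.
  rewrite !expnS expn0; nia.
exists s => j c cF; have [Nj|Nj] := eqVneq (N j) set0.
  by rewrite Nj setI0 /dev !big_set0 mulr0 expr0n.
have -> : c :&: N j = (c :\: U j) :&: N j.
  apply/setP => e; rewrite !inE; case: (boolP (e \in N j)) => [eN|]; last by rewrite !andbF.
  by have := subsetP (NU j) _ eN; rewrite inE => ->.
have Pk : P (j, c :\: U j).
  by rewrite /P Nj /=; apply/imsetP; exists c; rewrite ?inE ?cF ?subsetT.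
have := Hs _ Pk; rewrite /b /v /= (_ : 8 * (8 * _ * _) = 64 * K%:R *
  (multiplicity (d j) (c :\: U j))%:R); last by ring.
congr (_ ^+ 2 <= _ * _); last first.
  by rewrite [RHS]big_mkcond /=; apply: eq_bigr => e _; case: ifP; rewrite // expr0n.
rewrite /dev [RHS]big_mkcond; apply: eq_bigr => e _.
by case: (e \in _); rewrite // oppr0 if_same.
Qed.

End Levels.

(** * Halving the support *)

(** Here [x] is the error from small scales and [y] that from large ones. As
    [1024 / 2304 = (2/3) ^ 2] and [256 = 2304 / 9], they take 2/3 and 1/3 of the allowed
    [delta * W]. *)
Lemma halving_error_arith (R : realFieldType) (nr l k delta W x y : R) :
  0 < nr -> l <= nr -> 0 < l -> 1 <= k -> 0 <= delta -> 0 <= W -> 0 <= y ->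
  2304 * k ^+ 2 * l <= delta ^+ 2 * nr -> y ^+ 2 <= 1024 * k ^+ 2 * l / nr * W ^+ 2 ->
  x <= 16 * l / nr * W -> x + y <= delta * W.
Proof.
move=> nr0 lnr l0 k1 delta0 W0 y0 hd ysq xle.
have yle : y <= 2/3 * delta * W.
  rewrite -(ler_pXn2r (isT : (0 < 2)%N)) ?nnegrE ?mulr_ge0 ?invr_ge0 //.
  apply: (le_trans ysq); rewrite [leRHS]exprMn ler_wpM2r ?sqr_ge0 //.
  rewrite ler_pdivrMr //; lra.
have ratio : 16 * l / nr <= 1/3 * delta.
  rewrite -(ler_pXn2r (isT : (0 < 2)%N)) ?nnegrE ?mulr_ge0 ?invr_ge0 ?(ltW l0) ?(ltW nr0) //.
  rewrite -(ler_pM2r nr0).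
  apply: (@le_trans _ _ (256 * l)).
    rewrite (_ : _ * nr = 256 * l * (l / nr)); last by field; rewrite lt0r_neq0.
    by rewrite ler_piMr ?mulr_ge0 ?(ltW l0) // ler_pdivrMr // mul1r.
  have k2 : l <= k ^+ 2 * l by rewrite ler_peMl ?(ltW l0) // exprn_ege1.
  lra.
have := ler_wpM2r W0 ratio; lra.
Qed.

Section Halving.
Variables (R : realType) (T : finType) (F : {set {set T}}) (w : T -> R).
Hypothesis w_ge0 : forall i, 0 <= w i.

(** Start from the zero-weight coordinates and let [mu] be the least nonzero weight: density at
    scale [mu] holds because height is at most the number of remaining coordinates. Then apply
    [exists_dense] repeatedly. Once [mu * 2 ^ J] exceeds the total weight, density forces height 0
    above [U J]. *)
Lemma dense_filtration : (0 < #|[set e | w e != 0%R]|)%N ->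
  exists (mu : R) (U : nat -> {set T}) (J : nat),
  [/\ 0 < mu, U 0%N = [set e | w e == 0],
      (forall j, U j \subset U j.+1) /\ (forall j, dense F w (mu * 2 ^+ j) (U j)),
      forall j, weight w (U j.+1 :\: U j) <=
        mu * 2 ^+ j.+1 * ((height F (U j) setT)%:R - (height F (U j.+1) setT)%:R) &
      forall c, c \in F -> c \subset U J].
Proof.
case/card_gt0P => e0; rewrite inE => we0.
case: (@arg_minP _ _ _ e0 (fun e => w e != 0) w we0) => e1 we1 mine1.
pose mu := w e1; have mu0 : 0 < mu by rewrite lt_def we1 w_ge0.
have d0 j : 0 < mu * 2 ^+ j by rewrite mulr_gt0 ?exprn_gt0.
have [f Hf] := choice (fun p : nat * {set T} =>
  exists_dense F w_ge0 p.2 (ltW (d0 p.1))).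
pose U := fix U j := if j is k.+1 then f (k.+1, U k) else [set e | w e == 0].
have [J HJ] : exists J, weight w setT < mu * 2 ^+ J.
  exists (Num.truncn (weight w setT / mu)).+1; rewrite mulrC -ltr_pdivrMr //.
  apply: (lt_le_trans (truncnS_gt _)); rewrite -natrX ler_nat; exact/ltnW/ltn_expl.
have dU j : dense F w (mu * 2 ^+ j) (U j).
  case: j => [|j]; last by case: (Hf (j.+1, U j)).
  move=> Y sUY; rewrite expr0 mulr1.
  apply: (@le_trans _ _ (mu * #|Y :\: U 0%N|%:R)).
    by rewrite ler_pM2l // ler_nat height_le_card.
  rewrite mulr_natr -sumr_const; apply: ler_sum => e; rewrite !inE => /andP[we _].
  exact: mine1.
exists mu, U, J; split => // [|j|c cF].
- by split => // j; case: (Hf (j.+1, U j)).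
- by case: (Hf (j.+1, U j)).
apply: (@height_eq0_sub _ F _ setT) => //; apply/eqP; rewrite -leqn0 -ltnS.
have := le_lt_trans (dU J _ (subsetT _)) (le_lt_trans (weightS w_ge0 (subsetT _)) HJ).
by rewrite -{2}[mu * _]mulr1 ltr_pM2l // (ltr_nat _ _ 1).
Qed.

Lemma sum_layers (U : nat -> {set T}) (A : {set T}) J (g : T -> R) :
  (forall j, U j \subset U j.+1) ->
  \sum_(e in A :&: U J) g e =
  \sum_(e in A :&: U 0%N) g e + \sum_(j < J) \sum_(e in A :&: (U j.+1 :\: U j)) g e.
Proof.
move=> sU; elim: J => [|J IHJ]; first by rewrite big_ord0 addr0.
rewrite big_ord_recr /= addrA -IHJ (big_setID (U J)) /=; congr (_ + _).
  by apply: eq_bigl => e; rewrite !inE; case: (boolP (e \in U J)) (subsetP (sU J) e) => [_ ->|]; rewrite ?andbF ?andbT.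
by apply: eq_bigl => e; rewrite !inE andbCA.
Qed.

Lemma card_layers (U : nat -> {set T}) J : (forall j, U j \subset U j.+1) ->
  (#|U J| = #|U 0%N| + \sum_(j < J) #|U j.+1 :\: U j|)%N.
Proof.
move=> sU; elim: J => [|J IHJ]; first by rewrite big_ord0 addn0.
by rewrite big_ord_recr /= addnA -IHJ -(cardsID (U J)) (setIidPr (sU J)).
Qed.

(** At most [n / 4] heavy coordinates are kept, together with at most half of the light ones, hence
    at most [n / 4 + (3 * n / 4) / 2 = 5 * n / 8] coordinates. *)
Lemma halving (n K L : nat) (delta : R) :
  #|[set e | w e != 0]| = n -> (height F set0 setT <= L)%N -> (0 < L)%N ->
  (L <= n)%N -> (n.+1 <= 2 ^ K)%N -> 0 <= delta ->
  2304 * K%:R ^+ 2 * L%:R <= delta ^+ 2 * n%:R ->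
  exists w' : T -> R, [/\ forall e, 0 <= w' e,
    (8 * #|[set e | w' e != 0%R]| <= 5 * n)%N &
    forall c, c \in F -> `|weight w' c - weight w c| <= delta * weight w c].
Proof.
move=> cardn hL L0 Ln nK delta0 hdelta.
have n0 : (0 < n)%N := leq_trans L0 Ln.
have [|mu [U [J [mu0 U0 [sU dU] wU coverU]]]] := dense_filtration; first by rewrite cardn.
pose d j := mu * 2 ^+ j; have d0 j : 0 < d j by rewrite mulr_gt0 ?exprn_gt0.
have dS j : d j.+1 = 2 * d j by rewrite /d exprS; ring.
pose N j := U j.+1 :\: U j.
(* At most [n / 4] coordinates are heavy, since [sum_j w(N_j) / d_(j+1) <= L]. *)
pose light j e := w e * n%:R < 4 * L%:R * d j.+1.
pose A j := [set e in N j | light j e].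
pose H j := [set e in N j | ~~ light j e].
have sU0 j : U 0%N \subset U j by elim: j => // j IHj; apply: subset_trans IHj (sU j).
have cardC0 : #|~: U 0%N| = n.
  by rewrite U0 -cardn; apply: eq_card => e; rewrite !inE.
have cardUC j : (#|~: U j| <= n)%N.
  by rewrite -cardC0; apply: subset_leq_card; rewrite setCS.
have cardN : (\sum_(j < J) #|N j| <= n)%N.
  have : (#|U J| = #|U 0%N| + \sum_(j < J) #|N j|)%N := card_layers J sU.
  have := cardsC (U 0%N); have := subset_leq_card (subsetT (U J)).
  rewrite cardC0 cardsT; lia.
have cardNAH j : #|N j| = (#|A j| + #|H j|)%N.
  rewrite -(cardsID [set e | light j e]); congr (_ + _)%N; apply: eq_card => e; rewrite !inE //.
  by rewrite andbC.
have cardH : (4 * \sum_(j < J) #|H j| <= n)%N.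
  have : (\sum_(j < J) #|H j|)%:R * (4 * L%:R) <= n%:R * ((height F (U 0%N) setT)%:R : R).
    have -> : ((height F (U 0%N) setT)%:R : R) = (height F (U J) setT)%:R +
        \sum_(j < J) ((height F (U j) setT)%:R - (height F (U j.+1) setT)%:R).
      elim: (J) => [|k IHk]; first by rewrite big_ord0 addr0.
      by rewrite big_ord_recr /= {1}IHk; ring.
    rewrite natr_sum mulr_suml mulrDr; apply: ler_wpDl; first by rewrite mulr_ge0.
    rewrite mulr_sumr; apply: ler_sum => j _; rewrite -(ler_pM2r (d0 j.+1)).
    apply: (@le_trans _ _ (n%:R * weight w (N j))); last first.
      by rewrite -mulrA ler_wpM2l // mulrC wU.
    apply: (@le_trans _ _ (n%:R * weight w (H j))); last first.
      by rewrite ler_wpM2l // weightS //; apply/subsetP => e; rewrite inE => /andP[].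
    have -> : #|H j|%:R * (4 * L%:R) * d j.+1 = \sum_(e in H j) 4 * L%:R * d j.+1.
      by rewrite sumr_const -[RHS]mulr_natl -!mulrA.
    rewrite /weight mulr_sumr; apply: ler_sum => e.
    by rewrite inE /light -leNgt => /andP[_]; rewrite [w e * _]mulrC.
  have : n%:R * ((height F (U 0%N) setT)%:R : R) <= n%:R * L%:R.
    by rewrite ler_wpM2l // ler_nat (leq_trans _ hL) // heightS ?sub0set.
  move=> h1 h2; have := le_trans h2 h1; rewrite -!natrM ler_nat => h3.
  by rewrite -(leq_pmul2r L0) [(4 * _)%N]mulnC -mulnA.
have sA j : A j \subset ~: U j.
  by apply/subsetP => e; rewrite !inE => /andP[/andP[]].
have cardA : (\sum_(j < J) #|A j| <= n)%N.
  by apply: leq_trans cardN; apply: leq_sum => j _; rewrite cardNAH leq_addr.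
have [s0 Hs0] := level_signs w_ge0 d0 dU cardUC sA cardA n0 nK.
pose kept (s : {ffun T -> bool}) j := [set e in A j | s e].
(* Negating all signs preserves the squared deviations, so of [s0] and its negation one may take the
   vector that keeps fewer coordinates. *)
have [s Hs balance] : exists2 s, forall (j : 'I_J) c, c \in F ->
    dev w s (c :&: A j) ^+ 2 <=
    64 * K%:R * (multiplicity w (d j) (c :\: U j))%:R * \sum_(e in c :&: A j) w e ^+ 2 &
    (2 * \sum_(j < J) #|kept s j| <= \sum_(j < J) #|A j|)%N.
  pose s1 : {ffun T -> bool} := [ffun e => ~~ s0 e].
  have dev1 B : dev w s1 B = - dev w s0 B.
    rewrite /dev -sumrN; apply: eq_bigr => e _; rewrite ffunE.
    by case: (s0 e) => /=; rewrite ?opprK.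
  have eqA : (\sum_(j < J) #|A j| = \sum_(j < J) #|kept s0 j| + \sum_(j < J) #|kept s1 j|)%N.
    rewrite -big_split /=; apply: eq_bigr => j _.
    rewrite -(cardsID [set e | s0 e]); congr (_ + _)%N; apply: eq_card => e; rewrite !inE //.
    by rewrite ffunE andbC.
  case: (leqP (\sum_(j < J) #|kept s0 j|) (\sum_(j < J) #|kept s1 j|)) => cmp.
    by exists s0 => //; rewrite eqA; lia.
  exists s1; last by rewrite eqA; lia.
  by move=> j c cF; rewrite dev1 sqrrN Hs0.
pose f j e := if e \in A j then (if s e then 2 * w e else 0) else w e.
(* The layers are disjoint, so at most one term is nonzero. Outside all layers the value is 0: there
   either [w] vanishes or no word reaches. *)
pose w' e := \sum_(j < J) (if e \in N j then f j e else 0).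
have f0 j e : 0 <= f j e by rewrite /f; do 2?case: ifP => _; rewrite ?mulr_ge0.
exists w'; split => [e||c cF].
- by apply: sumr_ge0 => j _; case: ifP.
- have sub : [set e | w' e != 0] \subset \bigcup_(j < J) (H j :|: kept s j).
    apply/subsetP => e; rewrite inE; apply: contraR => /bigcupP nin.
    rewrite /w' big1 // => j _; case: ifP => // eN; case: (boolP (e \in H j :|: kept s j)) => [ein|].
      by case: nin; exists j.
    rewrite in_setU [e \in H j]in_set [e \in kept s j]in_set /f [e \in A j]in_set eN.
    by case: (light j e) => //=; case: (s e).
  have leHK : (#|[set e | w' e != 0%R]| <= \sum_(j < J) #|H j| + \sum_(j < J) #|kept s j|)%N.
    apply: leq_trans (subset_leq_card sub) _; rewrite -big_split /=.
    elim/big_rec2: _ => [|j k B _ le]; first by rewrite cards0.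
    by apply: leq_trans (leq_card_setU _ _) _; apply: leq_add => //; apply: leq_card_setU.
  have cardAH : (\sum_(j < J) #|A j| + \sum_(j < J) #|H j| <= n)%N.
    by move: cardN; rewrite (eq_bigr (fun j : 'I_J => #|A j| + #|H j|)%N (fun (j : 'I_J) _ => cardNAH j)) big_split.
  move: (\sum_(j < J) #|A j|)%N (\sum_(j < J) #|H j|)%N (\sum_(j < J) #|kept s j|)%N
    #|_| balance cardH leHK cardAH => x y z t; lia.
set W := weight w c.
have W0 : 0 <= W by apply: weight_ge0.
pose a j := weight w (c :&: N j); pose D j := dev w s (c :&: A j).
have a0 j : 0 <= a j by apply: weight_ge0.
have WE : W = \sum_(j < J) a j.
  rewrite /W /weight -{1}(setIidPl (coverU c cF)) (sum_layers _ _ _ sU) big1 ?add0r //.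
  by move=> e; rewrite U0 !inE => /andP[_ /eqP].
have W'E : weight w' c = \sum_(j < J) (a j + D j).
  rewrite /weight /w' exchange_big /=; apply: eq_bigr => j _.
  rewrite /a /D /dev /weight -big_mkcondr /=.
  rewrite (eq_bigl (mem (c :&: N j))); last by move=> e; rewrite /= !inE.
  have sAN : c :&: A j \subset c :&: N j.
    by apply: setIS; apply/subsetP => e; rewrite inE => /andP[].
  rewrite (big_setID (c :&: A j)) /= (setIidPr sAN).
  rewrite [X in _ = X + _](big_setID (c :&: A j)) /= (setIidPr sAN) addrAC -big_split /=.
  congr (_ + _); apply: eq_bigr => e.
    by rewrite !inE /f => /andP[_ eA]; rewrite !inE eA; case: ifP => _; [ring|rewrite subrr].
  by rewrite in_setD in_setI => /andP[neA /setIP[ec _]]; move: neA; rewrite ec /f => /negPf /= ->.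
have -> : weight w' c - W = \sum_(j < J) D j.
  by rewrite W'E {1}WE big_split /= addrAC subrr add0r.
apply: (le_trans (ler_norm_sum _ _ _)).
have nR0 : 0 < (n%:R : R) by rewrite ltr0n.
(* Small scales contribute a geometric series; a scale with [d_j > W] does not
   meet [c] at all; at most [K] scales remain. *)
pose small j := mu * 2 ^+ j <= W / n%:R.
pose large j := (W < n%:R * (mu * 2 ^+ j)) && (mu * 2 ^+ j <= W).
have lightw j e : e \in A j -> w e <= 8 * L%:R * d j / n%:R.
  rewrite inE => /andP[_ /ltW]; rewrite dS ler_pdivlMr // => le.
  by apply: (le_trans le); rewrite le_eqVlt; apply/orP; left; apply/eqP; ring.
have coef0 j : 0 <= 8 * L%:R * d j / n%:R.
  by apply: divr_ge0 => //; apply: mulr_ge0; [rewrite mulr_ge0|rewrite ltW].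
(* Worst case without any cancellation: at most [n] light coordinates, each of weight at most
   [8 * L * d j / n]. *)
have smallD (j : 'I_J) : small j -> `|D j| <= 8 * L%:R * (mu * 2 ^+ j).
  move=> _; rewrite /D /dev; apply: (le_trans (ler_norm_sum _ _ _)).
  apply: (@le_trans _ _ (\sum_(e in A j) 8 * L%:R * d j / n%:R)).
    rewrite [leRHS](big_setID c) /= setIC; apply: ler_wpDr.
      by apply: sumr_ge0 => e _; exact: coef0.
    rewrite setIC [X in _ <= X](eq_bigl (mem (c :&: A j))); last by move=> e; rewrite /= setIC.
    apply: ler_sum => e /setIP[_ eA]; apply: le_trans (lightw _ _ eA).
    by case: ifP => _; rewrite ?normrN ger0_norm.
  rewrite sumr_const -[leLHS]mulr_natr -mulrA -/(d j).
  have c0 : 0 <= 8 * L%:R * d j by apply: mulr_ge0; [rewrite mulr_ge0|rewrite ltW].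
  apply: ler_piMr c0 _.
  rewrite mulrC ler_pdivrMr // mul1r ler_nat.
  by apply: leq_trans (subset_leq_card (sA j)) (cardUC j).
(* A nonempty trace makes the height at least 1, so density gives it weight [d j]. *)
have trace_ge j : ~~ (c \subset U j) -> d j <= weight w (c :\: U j).
  move=> cU; have := dU j (U j :|: c) (subsetUl _ _); rewrite setDUl setDv set0U.
  apply: le_trans; rewrite ler_peMr ?(ltW (d0 j)) // (ler_nat _ 1) lt0n.
  by apply: contra cU => /eqP h0; apply: (height_eq0_sub h0 cF); apply: subsetUr.
have D_eq0 j : c \subset U j -> D j = 0.
  move=> cU; rewrite /D (_ : c :&: A j = set0) ?/dev ?big_set0 //.
  apply/eqP; rewrite -subset0; apply/subsetP => e /setIP[ec eA].
  by have := subsetP (sA j) _ eA; rewrite inE (subsetP cU).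
(* The factor [1 / d j] in the bound on the multiplicity cancels the [d j] in the bound on light
   weights; [64 * 2 * 8 = 1024]. *)
have largeD (j : 'I_J) : large j -> D j ^+ 2 <= 1024 * K%:R * L%:R / n%:R * W * a j.
  move=> _; case: (boolP (c \subset U j)) => [/D_eq0->|/trace_ge dW].
    by rewrite expr0n ?mulr_ge0 ?invr_ge0.
  have := Hs j c cF; set M : R := (multiplicity _ _ _)%:R; set V := \sum_(e in _) _ => le.
  apply: (le_trans le).
  have M0 : 0 <= M by rewrite ler0n.
  have Mle : M <= 2 * W / d j.
    apply: (le_trans (multiplicity_le w_ge0 (d0 j) dW)).
    by rewrite ler_pM2r ?invr_gt0 // ler_pM2l // weightS // subsetDl.
  have Vle : V <= 8 * L%:R * d j / n%:R * a j.
    apply: (@le_trans _ _ (8 * L%:R * d j / n%:R * weight w (c :&: A j))).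
      rewrite /V /weight mulr_sumr; apply: ler_sum => e /setIP[_ eA].
      by rewrite expr2 ler_wpM2r // lightw.
    apply: ler_wpM2l (coef0 j) _ _ _; rewrite /a weightS // setIS //.
    by apply/subsetP => e; rewrite inE => /andP[].
  have V0 : 0 <= V by apply: sumr_ge0 => e _; apply: sqr_ge0.
  have -> : 1024 * K%:R * L%:R / n%:R * W * a j =
     64 * K%:R * ((2 * W / d j) * (8 * L%:R * d j / n%:R * a j)).
    by field; rewrite !lt0r_neq0.
  by rewrite -mulrA ler_wpM2l ?mulr_ge0 // ler_pM.
have otherD (j : 'I_J) : ~~ small j -> ~~ large j -> D j = 0.
  rewrite /small /large ler_pdivlMr // [_ * n%:R]mulrC -ltNge => -> /=.
  rewrite -ltNge => ltW.
  apply: D_eq0; apply: contraTT ltW => /trace_ge cU; rewrite -leNgt.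
  by apply: (le_trans cU); rewrite weightS // subsetDl.
pose y := \sum_(j < J | large j) `|D j|.
(* Cauchy-Schwarz over the at most [K] large scales; the second factor [K] comes from [largeD], and
   the [a j] sum to [W]. *)
have ysq : y ^+ 2 <= 1024 * K%:R ^+ 2 * L%:R / n%:R * W ^+ 2.
  have nK' : (n <= 2 ^ K)%N by apply: leq_trans nK.
  apply: (le_trans (sqr_sum_le (fun j : 'I_J => large j) _)).
  apply: (@le_trans _ _ (K%:R * (1024 * K%:R * L%:R / n%:R * W * W))); last first.
    by rewrite le_eqVlt; apply/orP; left; apply/eqP; ring.
  apply: ler_pM => //; first by apply: sumr_ge0 => j _; apply: sqr_ge0.
    by rewrite ler_nat; apply: (card_scales_le W J mu0 nK').
  rewrite [X in _ <= _ * X]WE mulr_sumr big_mkcond /=; apply: ler_sum => j _; case: ifP => [lj|_].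
    by rewrite real_normK ?num_real // largeD.
  by rewrite !mulr_ge0 ?invr_ge0.
have y0 : 0 <= y by apply: sumr_ge0.
have xle : \sum_(j < J | small j) `|D j| <= 16 * L%:R / n%:R * W.
  apply: (le_trans (ler_sum _ smallD)); rewrite -mulr_sumr.
  have := sum_scales_le J mu0 (divr_ge0 W0 (ltW nR0)).
  rewrite -(ler_pM2l (_ : 0 < 8 * L%:R)) ?mulr_gt0 ?ltr0n // => h; apply: (le_trans h).
  by rewrite le_eqVlt; apply/orP; left; apply/eqP; ring.
have splitD : \sum_(j < J) `|D j| <= \sum_(j < J | small j) `|D j| + y.
  rewrite /y [X in X + _]big_mkcond [X in _ + X]big_mkcond /= -big_split /=.
  apply: ler_sum => j _; case: (boolP (small j)) => sj; case: (boolP (large j)) => lj;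
    rewrite ?addr0 ?add0r ?lerDl //.
  by rewrite otherD // normr0.
apply: (le_trans splitD).
have LnR : L%:R <= (n%:R : R) by rewrite ler_nat.
have L0R : 0 < (L%:R : R) by rewrite ltr0n.
have K1 : 1 <= (K%:R : R).
  rewrite (ler_nat _ 1); case: (posnP K) => // K0; move: nK.
  by rewrite K0 expn0 ltnS leqNgt n0.
exact: (halving_error_arith nR0 LnR L0R K1 delta0 W0 y0 hdelta ysq xle).
Qed.

End Halving.

(** * Iterated halving *)

(* [2 ^ 27] is a power of two above [2304 * 64 * (8/5) * 18 ^ 2]. *)
Lemma iteration_arith (R : realFieldType) (k : nat) (a l m n eps : R) :
  1 <= a -> 0 <= l -> 8 ^+ k * m <= 5 ^+ k * n -> 2 ^+ 27 * a ^+ 2 * l <= m * eps ^+ 2 ->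
  2304 * (a + k.+1%:R) ^+ 2 * l <= (eps / 18 * (9/10) ^+ k.+1) ^+ 2 * n.
Proof.
move=> a1 l0 hn hm.
have bern : k.+2%:R <= 8 * (9/8 : R) ^+ k.+1.
  elim: k {hn} => [|k IHk]; first by rewrite expr1; lra.
  have p1 : 1 <= (9/8 : R) ^+ k.+1 by apply: exprn_ege1; lra.
  by rewrite exprS -natr1; lra.
set u := (9/8 : R) ^+ k.+1 in bern; set v := (9/10 : R) ^+ k.+1.
set r := (8/5 : R) ^+ k.
have u0 : 0 <= u by rewrite exprn_ge0 //; lra.
have r0 : 0 <= r by rewrite exprn_ge0 //; lra.
have rm : r * m <= n.
  rewrite /r expr_div_n mulrAC ler_pdivrMr ?exprn_gt0 //; lra.
(* This is [(9/8) ^ 2 = (9/10) ^ 2 * (25/16)] with [25/16 <= 8/5]: the surplus of coordinates pays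
   for both the shrinking tolerance and the growing logarithm. *)
have uv : u ^+ 2 <= v ^+ 2 * (8/5 * r).
  rewrite /u /v /r -exprS -!exprM ![(k.+1 * 2)%N]mulnC !exprM -exprMn.
  by apply: lerXn2r; rewrite ?nnegrE; lra.
have ale : a + k.+1%:R <= a * (8 * u).
  apply: (@le_trans _ _ (a * k.+2%:R)); last by rewrite ler_wpM2l //; lra.
  have : 0 <= (a - 1) * k.+1%:R by rewrite mulr_ge0 //; lra.
  by rewrite -[k.+2%:R]natr1; lra.
have sq : (a + k.+1%:R) ^+ 2 <= 64 * (a ^+ 2 * u ^+ 2).
  rewrite (_ : 64 * _ = (a * (8 * u)) ^+ 2); last by ring.
  by apply: lerXn2r; rewrite ?nnegrE ?addr_ge0 ?mulr_ge0 //; lra.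
have al0 : 0 <= a ^+ 2 * l by rewrite mulr_ge0 ?sqr_ge0.
apply: (@le_trans _ _ (2304 * 64 * (a ^+ 2 * l) * u ^+ 2)).
  by have := ler_wpM2r l0 sq; lra.
apply: (@le_trans _ _ (2304 * 64 * (a ^+ 2 * l) * (v ^+ 2 * (8/5 * r)))).
  by apply: (ler_wpM2l _ uv); apply: mulr_ge0 al0; rewrite mulr_ge0.
apply: (@le_trans _ _ (v ^+ 2 * (eps ^+ 2 / 324) * (r * m))); last first.
  rewrite (_ : (eps / 18 * v) ^+ 2 * n = v ^+ 2 * (eps ^+ 2 / 324) * n); last by field.
  by apply: ler_wpM2l rm; rewrite mulr_ge0 ?sqr_ge0 // mulr_ge0 ?sqr_ge0 ?invr_ge0.
have vr : 0 <= v ^+ 2 * r by rewrite mulr_ge0 ?sqr_ge0.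
have := ler_wpM2l vr hm; have := mulr_ge0 vr al0; lra.
Qed.

Section Iteration.
Variables (R : realType) (T : finType) (F : {set {set T}}).
Variables (M L K : nat) (eps : R).
Hypotheses (L0 : (0 < L)%N) (LM : (L <= M)%N) (hL : (height F set0 setT <= L)%N).
Hypotheses (MK : (M.+1 <= 2 ^ K)%N) (eps0 : 0 < eps) (eps1 : eps < 1).
Hypothesis M_large : 2 ^+ 27 * K%:R ^+ 2 * L%:R <= M%:R * eps ^+ 2.

(** Here [k] bounds the rounds still to come. Early rounds have many coordinates and so get the
    smallest tolerances; the sum of [eps / 10 * (9/10) ^ i] over [i < k] is the stated error. *)
Lemma sparsify_iter k (w : T -> R) : (forall e, 0 <= w e) ->
  (5 ^ k * #|[set e | w e != 0%R]| <= 8 ^ k * M)%N ->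
  exists w' : T -> R, [/\ forall e, 0 <= w' e, (#|[set e | w' e != 0%R]| <= M)%N &
    forall c, c \in F ->
      `|weight w' c - weight w c| <= eps * (1 - (9/10) ^+ k) * weight w c].
Proof.
elim: k w => [|k IHk] w w0.
  rewrite !expn0 !mul1n => cw; exists w; split => // c _.
  by rewrite !subrr normr0 mulr0 mul0r.
have g0 : 0 <= (9/10 : R) ^+ k by rewrite exprn_ge0 //; lra.
have g1 : (9/10 : R) ^+ k <= 1 by rewrite exprn_ile1 //; lra.
have gS : (9/10 : R) ^+ k.+1 = 9/10 * (9/10) ^+ k by rewrite exprS.
set n := #|_| => nle.
(* If [k] rounds already suffice, this round is skipped; otherwise [n] exceeds [(8/5) ^ k * M], the
   lower bound that [iteration_arith] needs. *)
case: (leqP (5 ^ k * n)%N (8 ^ k * M)%N) => [/IHk[//|w' [w'0 cw' app]]|ngt].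
  exists w'; split => // c cF; apply: (le_trans (app c cF)).
  by rewrite ler_wpM2r ?weight_ge0 // ler_pM2l // gS; lra.
have Ln : (L <= n)%N.
  apply: (leq_trans LM); rewrite -(@leq_pmul2l (5 ^ k)) ?expn_gt0 //.
  apply: leq_trans (ltnW ngt); rewrite leq_mul2r; apply/orP; right.
  by case: (k) => // j; rewrite leq_exp2r.
have K0 : (0 < K)%N.
  by case: (posnP K) => // Kz; move: MK; rewrite Kz expn0 ltnS leqNgt (leq_trans L0 LM).
have nK : (n.+1 <= 2 ^ (K + k.+1))%N.
  have : (n <= 2 ^ k.+1 * M)%N.
    rewrite -(@leq_pmul2l (5 ^ k.+1)) ?expn_gt0 //; apply: (leq_trans nle).
    by rewrite mulnA -expnMn leq_mul2r leq_exp2r ?orbT.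
  have : (2 ^ k.+1 * M.+1 <= 2 ^ (K + k.+1))%N by rewrite expnD mulnC leq_mul2r MK orbT.
  have : (0 < 2 ^ k.+1)%N by rewrite expn_gt0.
  by rewrite mulnS; lia.
pose delta := eps / 18 * (9/10) ^+ k.+1.
have d0 : 0 <= delta.
  by apply: mulr_ge0; [apply: divr_ge0 => //; apply: ltW | apply: exprn_ge0; lra].
have hd : 2304 * (K + k.+1)%:R ^+ 2 * L%:R <= delta ^+ 2 * n%:R.
  rewrite natrD /delta; apply: iteration_arith M_large => //.
    by rewrite (ler_nat _ 1).
  by rewrite -!natrX -!natrM ler_nat ltnW.
have [w1 [w10 cw1 app1]] := halving w0 (erefl _) hL L0 Ln nK d0 hd.
have [|w2 [w20 cw2 app2]] := IHk w1 w10.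
  rewrite -(@leq_pmul2l 8) // mulnCA (leq_trans (_ : _ <= 5 ^ k * (5 * n))%N) //.
    by rewrite leq_mul2l cw1 orbT.
  by rewrite mulnCA !mulnA -!expnS.
exists w2; split => // c cF.
have := app1 c cF; have := app2 c cF; have := weight_ge0 w0 c.
set W := weight w c; set W1 := weight w1 c; set W2 := weight w2 c => W0 h2 h1.
have E0 : 0 <= eps * (1 - (9/10) ^+ k) by rewrite mulr_ge0 ?(ltW eps0) // subr_ge0.
have E1 : eps * (1 - (9/10) ^+ k) <= 1.
  by rewrite mulr_ile1 ?(ltW eps0) ?(ltW eps1) // ?subr_ge0 //; lra.
have W1le : W1 <= W + delta * W by have := ler_norm (W1 - W); lra.
have h3 := ler_wpM2l E0 W1le.
(* The later rounds err relative to [W1] rather than [W]; the cross term costs at most another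
   [delta * W], whence [2 * delta] in total. *)
have h4 : eps * (1 - (9/10) ^+ k) * (delta * W) <= delta * W.
  by rewrite ler_piMl // mulr_ge0.
have tri : `|W2 - W| <= `|W2 - W1| + `|W1 - W|.
  by apply: le_trans (ler_normD _ _); rewrite addrA subrK.
have dE : 2 * delta = eps / 10 * (9/10) ^+ k by rewrite /delta gS; lra.
have h5 : 2 * delta * W = eps / 10 * (9/10) ^+ k * W by rewrite dE.
apply: (le_trans tri); rewrite gS.
move: h1 h2 h3 h4 h5; set E := eps * (1 - _) => h1 h2 h3 h4 h5.
rewrite (_ : eps * (1 - _) * W = E * W + eps / 10 * (9/10) ^+ k * W); last by rewrite /E; field.
rewrite mulrDr in h3; lra.
Qed.

Lemma sparsify (w : T -> R) : (forall e, 0 <= w e) ->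
  exists w' : T -> R, [/\ forall e, 0 <= w' e, (#|[set e | w' e != 0%R]| <= M)%N &
    forall c, c \in F -> `|weight w' c - weight w c| <= eps * weight w c].
Proof.
move=> w0; set n := #|[set e | w e != 0%R]|.
(* Since [5 ^ 2 * 2 <= 8 ^ 2] and [n <= 2 ^ n], [2 * n] rounds are enough; the error stays below
   [eps] for any number of rounds. *)
have [|w' [w'0 cw' app]] := @sparsify_iter (2 * n) w w0.
  rewrite -/n !expnM; apply: (@leq_trans ((8 ^ 2) ^ n)); last first.
    by rewrite leq_pmulr // (leq_trans L0).
  apply: (@leq_trans ((5 ^ 2 * 2) ^ n)); last by case: (n) => // j; rewrite leq_exp2r.
  by rewrite expnMn leq_mul2l (ltnW (ltn_expl _ _)) ?orbT.
exists w'; split => // c cF; apply: (le_trans (app c cF)).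
rewrite ler_wpM2r ?weight_ge0 // ler_piMr ?(ltW eps0) //.
by rewrite lerBlDr lerDl exprn_ge0 //; lra.
Qed.

End Iteration.

Lemma sparsify_log (R : realType) (T : finType) (F : {set {set T}}) (w : T -> R)
    (L t : nat) (eps ell : R) :
  (forall e, 0 <= w e) -> (0 < L)%N -> (height F set0 setT <= L)%N ->
  0 < eps -> eps < 1 -> 1 <= ell -> ell <= t%:R -> t%:R <= 2 * ell ->
  L%:R / eps <= 2 ^+ t ->
  exists w' : T -> R, [/\ forall e, 0 <= w' e,
    #|[set e | w' e != 0%R]|%:R <= 2 ^+ 42 * (L%:R * ell ^+ 2) / eps ^+ 2 &
    forall c, c \in F -> `|weight w' c - weight w c| <= eps * weight w c].
Proof.
move=> w0 L0 hL eps0 eps1 ell1 ellt tell Lt.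
(* [M] depends on [K], yet [K] must bound the logarithm of [M + 1]. Taking [K = 64 * t] works:
   [x = 2 ^ 39 * z] with [z <= 2 ^ (4 * t)], and [40 + 4 * t <= 64 * t]. *)
pose x : R := 2 ^+ 27 * (64 * t)%:R ^+ 2 * L%:R / eps ^+ 2.
pose M := (Num.truncn x).+1.
have e2 : 0 < eps ^+ 2 by rewrite exprn_gt0.
have t1 : 1 <= (t%:R : R) by apply: le_trans ell1 ellt.
have L1 : 1 <= (L%:R : R) by rewrite (ler_nat _ 1).
pose z : R := t%:R ^+ 2 * (L%:R / eps ^+ 2).
have xz : x = 2 ^+ 39 * z by rewrite /x /z natrM; field; rewrite lt0r_neq0.
have Le : 1 <= L%:R / eps ^+ 2.
  rewrite ler_pdivlMr // mul1r; apply: le_trans L1; rewrite exprn_ile1 // ltW //.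
have Lez : L%:R / eps ^+ 2 <= z.
  by rewrite /z ler_peMl ?(le_trans ler01 Le) // exprn_ege1.
have z1 : 1 <= z by apply: le_trans Lez.
have Mle : M%:R <= x + 1.
  have : (Num.truncn x)%:R <= x by rewrite truncn_le xz mulr_ge0 ?exprn_ge0 //; lra.
  by rewrite /M -natr1; lra.
have xM : x < M%:R := truncnS_gt x.
have [|||w' [w'0 cw' app]] := @sparsify R T F M L (64 * t) eps L0 _ hL _ eps0 eps1 _ w w0.
- rewrite -(ler_nat R); apply: le_trans (ltW xM); rewrite xz.
  have : L%:R <= L%:R / eps ^+ 2.
    by rewrite ler_peMr ?ler0n // invf_ge1 // exprn_ile1 // ltW.
  have : z <= 2 ^+ 39 * z by rewrite ler_peMl ?exprn_ege1 //; lra.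
  lra.
- rewrite -(ler_nat R) -natr1 natrX.
  have zle : z <= 2 ^+ (4 * t).
    have -> : (2 : R) ^+ (4 * t) = (2 ^+ t) ^+ 2 * (2 ^+ t) ^+ 2.
      by rewrite -!exprM -exprD; congr (_ ^+ _); clear; lia.
    have p0 : 0 <= (2 : R) ^+ t by rewrite exprn_ge0.
    apply: ler_pM; rewrite ?exprn_ge0 ?(le_trans ler01 Le) //.
      apply: lerXn2r; rewrite ?nnegrE //.
      by rewrite -natrX ler_nat ltnW // ltn_expl.
    apply: (@le_trans _ _ ((L%:R / eps) ^+ 2)).
      rewrite expr_div_n ler_pM2r ?invr_gt0 // expr2 ler_peMl //; lra.
    by apply: lerXn2r; rewrite ?nnegrE // divr_ge0 // ltW.
  have tn : (0 < t)%N by rewrite -(ler_nat R).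
  apply: (@le_trans _ _ (2 ^+ 40 * 2 ^+ (4 * t))); last first.
    rewrite -exprD; apply: ler_weXn2l; first by rewrite ler1n.
    by move: tn; clear; lia.
  apply: (@le_trans _ _ (2 ^+ 40 * z)); last by rewrite ler_pM2l ?exprn_gt0.
  have : M%:R <= 2 ^+ 39 * z + 1 by rewrite -xz.
  have : 2 ^+ 2 * z <= 2 ^+ 39 * z by rewrite ler_pM2r; [apply: ler_weXn2l => //; lra|lra].
  rewrite [2 ^+ 40]exprS; set q := 2 ^+ 39 * z; rewrite -mulrA -/q; lra.
- by rewrite -ler_pdivrMr // ltW.
exists w'; split => //; apply: (@le_trans _ _ M%:R); first by rewrite ler_nat.
apply: (le_trans Mle); rewrite xz.
have q1 : 1 <= 2 ^+ 39 * z.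
  by apply: (le_trans z1); rewrite ler_peMl ?exprn_ege1 //; lra.
apply: (@le_trans _ _ (2 ^+ 40 * z)).
  by rewrite [2 ^+ 40]exprS; set q := 2 ^+ 39 * z in q1 *; rewrite -mulrA -/q; lra.
have tt : t%:R ^+ 2 <= (2 * ell) ^+ 2 by apply: lerXn2r; rewrite ?nnegrE //; lra.
rewrite (_ : 2 ^+ 42 * _ / _ = 2 ^+ 40 * ((2 * ell) ^+ 2 * (L%:R / eps ^+ 2))); last first.
  by field; rewrite lt0r_neq0.
rewrite ler_pM2l ?exprn_gt0 // ler_wpM2r //; lra.
Qed.

(** * Codes *)

Lemma increasing_unions_nth (T : finType) (U : {set T}) s i :
  increasing_unions U s -> (i < size s)%N ->
  exists2 j, j \in nth set0 s i & forall k, (k < i)%N -> j \notin nth set0 s k.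
Proof.
move=> inc lti; move: inc; rewrite -{1}(cat_take_drop i s) increasing_unions_cat.
rewrite (drop_nth set0 lti) /= => /and3P[_ /subsetPn[j ji jU] _]; exists j => // k ki.
apply: contra jU => jk; rewrite inE; apply/orP; right.
rewrite (big_nth set0) size_takel ?(ltnW lti) // big_mkord.
by apply/bigcupP; exists (Ordinal ki); rewrite //= nth_take.
Qed.

Definition word_support m (c : word m) : {set 'I_m} := [set i | c i].

(** Each word of a union chain owns a coordinate absent from all earlier words, and these
    coordinates give the map [a] of a chain. The triangular pattern makes both maps injective. *)
Lemma height_le_CL m (C : {set word m}) :
  (height (@word_support m @: C) set0 setT <= CL C)%N.
Proof.
have [s chs <-] := height_witness (@word_support m @: C) set0 setT.
have lem : (size s < m.+1)%N.
  by rewrite ltnS (leq_trans (size_union_chain chs)) // setD0 cardsT card_ord.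
have /andP[/allP allF inc] := chs.
have pick (i : 'I_(size s)) : exists p : 'I_m * word m,
    [/\ p.2 \in C, nth set0 s i = word_support p.2, p.1 \in nth set0 s i &
      forall k, (k < i)%N -> p.1 \notin nth set0 s k].
  have [j ji jk] := increasing_unions_nth inc (ltn_ord i).
  have /andP[/imsetP[c cC sc] _] := allF _ (mem_nth set0 (ltn_ord i)).
  by exists (j, c).
have [p Hp] := fin_all_exists pick.
apply: (@leq_bigmax_cond _ _ (fun l : 'I__ => val l) (Ordinal lem)).
have own i : (p i).2 (p i).1 by case: (Hp i) => _ -> + _; rewrite inE.
have other (i j : 'I_(size s)) : (i < j)%N -> ~~ (p i).2 (p j).1.
  by move=> ij; case: (Hp j) => _ _ _ /(_ _ ij); case: (Hp i) => _ -> _ _; rewrite inE.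
have inj (i j : 'I_(size s)) : (p i).1 = (p j).1 \/ (p i).2 = (p j).2 -> i = j.
  wlog: i j / (i <= j)%N => [wl h|].
    by case: (leqP i j) => [/wl->//|/ltnW/wl-> //]; case: h => ->; [left|right].
  rewrite leq_eqVlt => /orP[/eqP/val_inj//|/[dup] ij /other].
  by move=> h [e|e]; move: h; [rewrite -e own|rewrite e own].
apply/existsP; exists [ffun i => (p i).1]; apply/existsP; exists [ffun i => (p i).2].
apply/and5P; split.
- by apply/injectiveP => i j; rewrite !ffunE => h; apply: inj; left.
- by apply/injectiveP => i j; rewrite !ffunE => h; apply: inj; right.
- by apply/forallP => i; rewrite ffunE; case: (Hp i).
- by apply/forallP => i; rewrite !ffunE.
- by apply/forallP => i; apply/forallP => j; apply/implyP => ij; rewrite !ffunE other.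
Qed.

Lemma wtE m (w : 'I_m -> Rdefinitions.R) (c : word m) : wt w c = weight w (word_support c).
Proof. by rewrite /weight [RHS]big_mkcond /=; apply: eq_bigr => i _; rewrite inE. Qed.

Lemma suppE m (f : 'I_m -> Rdefinitions.R) : supp f = [set i | f i != 0].
Proof.
apply/setP => i; rewrite /supp !inE; case: Req_dec_T => fi; symmetry.
  by apply/negbTE; rewrite negbK; apply/eqP.
by apply/eqP => fi0; apply: fi.
Qed.

Local Open Scope R_scope.

Lemma le_pow2 (x : R) (t : nat) : 0 < x -> logc x <= INR t -> x <= 2 ^ t.
Proof.
move=> x0 xt; have ln2 : 0 < Rpower.ln 2 by rewrite -ln_1; apply: ln_increasing; Lra.lra.
have le : Rpower.ln x <= INR t * Rpower.ln 2.
  have h := Rle_trans _ _ _ (Rmax_l _ _) xt.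
  have := Rmult_le_compat_r _ _ _ (Rlt_le _ _ ln2) h.
  by rewrite /Rdiv Rmult_assoc Rinv_l ?Rmult_1_r //; apply: Rgt_not_eq.
rewrite -ln_pow in le; last by Lra.lra.
rewrite -(exp_ln x) // -(exp_ln (2 ^ t)); last by apply: pow_lt; Lra.lra.
by case: le => [/exp_increasing/Rlt_le|->]; [|apply: Rle_refl].
Qed.

Theorem mainTheorem1 :
  exists K : R, forall (m : nat) (C : {set word m}) (w : 'I_m -> R) (eps : R),
    (1 <= CL C)%N ->
    (forall i, 0 <= w i) ->
    0 < eps < 1 ->
    exists wt' : 'I_m -> R,
      is_sparsifier C w wt' eps /\
      INR #|supp wt'| <=
        K * (INR (CL C) * (logc (INR (CL C) / eps)) ^ 2
             * (logc (logc (INR (CL C) / eps))) ^ 2) / eps ^ 2.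
Proof.
exists (2 ^ 42) => m C w eps CL1 w0 [eps0 eps1].
set L := CL C in CL1 *; set ell := logc (INR L / eps).
have ell1 : 1 <= ell := Rmax_r _ _.
(* The truncation in [logc] makes this factor at least 1, so the bound from [sparsify_log] can be
   multiplied by it at the end. *)
have ll1 : 1 <= logc ell ^ 2 by apply: pow_R1_Rle; apply: Rmax_r.
have L0 : 0 < INR L by apply: lt_0_INR; apply/ssrnat.ltP.
have x0 : 0 < INR L / eps by apply: Rdiv_lt_0_compat.
(* An integer just above [ell]; it is at most [2 * ell] because [ell >= 1]. *)
pose t := (Num.truncn ell).+1.
have ell_t : ell <= INR t by apply/RleP; rewrite INRE; apply/ltW/truncnS_gt.
have t_ell : INR t <= 2 * ell.
  have : INR (Num.truncn ell) <= ell.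
    have ell0 : 0 <= ell by Lra.lra.
    by apply/RleP; rewrite INRE truncn_le; apply/RleP.
  by rewrite /t S_INR; Lra.lra.
have Lt := le_pow2 x0 ell_t.
have [|||||||||w' [w'0 cw' app]] := @sparsify_log R 'I_m (@word_support m @: C) w L t eps ell.
- by move=> i; apply/RleP.
- exact: CL1.
- exact: height_le_CL.
- exact/RltP.
- exact/RltP.
- exact/RleP.
- by rewrite -INRE; apply/RleP.
- by rewrite -INRE; apply/RleP.
- by move/RleP: Lt; rewrite !RealsE.
exists w'; split.
  split => [i|c cC]; first by apply/RleP.
  have : Rabs (wt w' c - wt w c) <= eps * wt w c.
    by rewrite !wtE !RealsE; apply/RleP; apply: app; apply: imset_f.
  by rewrite /Rabs; case: Rcase_abs => ?; Lra.lra.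
have le : INR #|supp w'| <= 2 ^ 42 * (INR L * ell ^ 2) / eps ^ 2.
  by rewrite suppE !RealsE; apply/RleP.
apply: (Rle_trans _ _ _ le); apply: Rmult_le_compat_r.
  by apply/Rlt_le/Rinv_0_lt_compat/pow_lt.
apply: Rmult_le_compat_l; first by apply: pow_le; Lra.lra.
rewrite -[X in X <= _]Rmult_1_r; apply: Rmult_le_compat_l => //.
by apply: Rmult_le_pos; [apply: Rlt_le|apply: pow2_ge_0].
Qed.
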